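(* Let $K\subset\mathbb{C}^d$ be compact and polynomial determining, let $z_0\in\mathbb{C}^d\setminus K$, and let $n\ge 0$ be an integer. Then $$\min_{\mu\in\mathcal{M}(K)}\ \max_{p\in\mathbb{C}_n[z],\,p(z_0)\ne0}\ \frac{|p(z_0)|^2}{\int_K|p(z)|^2\,d\mu}\;=\;\max_{p\in\mathbb{C}_n[z],\,p\neq0}\ \frac{|p(z_0)|^2}{\|p\|_K^2},$$ i.e., the minimum over $\mu\in\mathcal{M}(K)$ of the prediction variance $K_n^\mu(z_0,z_0)$ equals the square of the maximal value of $|p(z_0)|$ among $p\in\mathbb{C}_n[z]$ with $\|p\|_K\le1$.
   Context: $\mathbb{C}_n[z]$ is the space of complex polynomials of degree at most $n$ in $d$ complex variables; $\|p\|_K=\sup_{z\in K}|p(z)|$; $\mathcal{M}(K)$ is the set of (Borel) probability measures on $K$. $K$ is polynomial determining if the only polynomial vanishing at every point of $K$ is $0$. A quotient $|p(z_0)|^2/\int_K|p|^2d\mu$ with $p(z_0)\ne0$ and zero denominator is interpreted as $+\infty$, and $$K_n^\mu(z_0,z_0)=\sup_{p\in\mathbb{C}_n[z],\,p(z_0)\neq0}\frac{|p(z_0)|^2}{\int_K|p|^2d\mu}$$ (which coincides with $\sum_k|q_k(z_0)|^2$ for a $\mu$-orthonormal basis $\{q_k\}$ of $\mathbb{C}_n[z]$ when the Gram matrix of $\mu$ is non-singular). *)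

(* Defs.v *)
From HB Require Import structures.
From mathcomp Require Import all_boot all_order all_algebra.
From mathcomp Require Import mpoly.
From mathcomp Require Import complex.
From mathcomp Require Import all_classical all_reals all_analysis.

Set Implicit Arguments.
Unset Strict Implicit.
Unset Printing Implicit Defensive.

Import Order.TTheory GRing.Theory Num.Theory.
Import numFieldNormedType.Exports.

Local Open Scope classical_set_scope.
Local Open Scope ring_scope.

(* The usual topology of the complex numbers, given by the modulus; it is the
   one every numFieldType carries, registered here on the concrete type R[i]. *)
HB.instance Definition _ (R : realType) := NormedModule.copy R[i] R[i]^o.

(* The space C^d with its Borel sigma-algebra. *)
Notation borelC R d := (g_sigma_algebraType (@open 'rV[R[i]]_d)).

Section Definitions.
Variables (R : realType) (d : nat).
Implicit Types (K : set 'rV[R[i]]_d) (z : 'rV[R[i]]_d) (p : {mpoly R[i][d]}).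

(* The real-valued modulus |p(z)|; the norm `|_| of R[i] is R[i]-valued. *)
Definition polyabs p z : R := Normc.normc p.@[z 0].

(* msize is 1 + the total degree, and 0 for the zero polynomial. *)
Definition poly_deg_le (n : nat) : set {mpoly R[i][d]} :=
  [set p | (msize p <= n.+1)%N].

Definition polynomial_determining K :=
  forall p, (forall z, K z -> p.@[z 0] = 0) -> p = 0.

Definition supnorm K p : R := sup [set polyabs p z | z in K].

(* A Borel probability measure on a closed K is a Borel probability measure
   on C^d that gives K full mass. *)
Definition prob_on K : set (probability (borelC R d) R) :=
  [set mu | mu K = 1%E].

(* For p(z0) <> 0 and zero denominator this is +oo, since inve 0 = +oo. *)
Definition variance_ratio K (mu : probability (borelC R d) R) z0 p : \bar R :=
  ((polyabs p z0 ^+ 2)%:E / \int[mu]_(z in K) (polyabs p z ^+ 2)%:E)%E.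

Definition variance_ratios n K mu z0 : set (\bar R) :=
  [set variance_ratio K mu z0 p | p in
    [set p | poly_deg_le n p /\ p.@[z0 0] != 0]].

Definition prediction_variance n K mu z0 : \bar R :=
  ereal_sup (variance_ratios n K mu z0).

End Definitions.

Definition is_max {disp} {T : porderType disp} (A : set T) (m : T) :=
  A m /\ ubound A m.

Definition is_min {disp} {T : porderType disp} (A : set T) (m : T) :=
  A m /\ lbound A m.

(* Main.v *)
(* Among the p of degree at most n with p(z0) = 1 let p* have the least supremum norm M.
   For every mu, testing the variance with p* gives at least 1 / M^2. Conversely, the
   functional M ev_z0 is bounded by the supremum norm, so by the bipolar theorem in the
   finite-dimensional dual of C_n[z] it is an absolutely convex combination
   sum_i c_i ev_(z_i) of evaluations at points of K, with sum_i |c_i| <= 1; Caratheodory's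
   theorem bounds the number of points and hence makes the set of combinations compact.
   For the discrete measure mu with masses w_i >= |c_i| at the z_i, Jensen's inequality gives
   M^2 |p(z0)|^2 <= (sum_i w_i |p(z_i)|)^2 <= \int |p|^2 dmu for every p, so that the
   variance of mu is at most 1 / M^2. *)

Require Import Defs.
From HB Require Import structures.
From mathcomp Require Import all_boot all_order all_algebra.
From mathcomp Require Import mpoly.
From mathcomp Require Import complex.
From mathcomp Require Import all_classical all_reals all_analysis.
From mathcomp Require Import measurable_realfun.
From mathcomp Require Import ring lra.

Set Implicit Arguments.
Unset Strict Implicit.
Unset Printing Implicit Defensive.

Import Order.TTheory GRing.Theory Num.Theory.
Import numFieldNormedType.Exports.

Local Open Scope classical_set_scope.
Local Open Scope ring_scope.
Import Normc.

(** * Complex numbers *)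

Section continuous_num.
Variables (F : numFieldType) (X : topologicalType).

Lemma continuousD_num (f g : X -> F) :
  continuous f -> continuous g -> continuous (fun x => f x + g x : F).
Proof. by move=> cf cg x; apply: cvgD; [exact: cf|exact: cg]. Qed.

Lemma continuousM_num (f g : X -> F) :
  continuous f -> continuous g -> continuous (fun x => f x * g x : F).
Proof. by move=> cf cg x; apply: cvgM; [exact: cf|exact: cg]. Qed.

Lemma continuous_sum_num (I : Type) (s : seq I) (P : pred I) (f : I -> X -> F) :
  (forall i, continuous (f i)) -> continuous (fun x => \sum_(i <- s | P i) f i x : F).
Proof.
move=> cf; elim: s => [|i s IH].
  by under eq_fun do rewrite big_nil; move=> x; exact: cvg_cst.
under eq_fun do rewrite big_cons.
case: (P i); last exact: IH.
apply: continuousD_num; [exact: cf|exact: IH].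
Qed.

Lemma continuous_prod_num (I : Type) (s : seq I) (P : pred I) (f : I -> X -> F) :
  (forall i, continuous (f i)) -> continuous (fun x => \prod_(i <- s | P i) f i x : F).
Proof.
move=> cf; elim: s => [|i s IH].
  by under eq_fun do rewrite big_nil; move=> x; exact: cvg_cst.
under eq_fun do rewrite big_cons.
case: (P i); last exact: IH.
apply: continuousM_num; [exact: cf|exact: IH].
Qed.

Lemma continuous_exp_num (n : nat) (f : X -> F) :
  continuous f -> continuous (fun x => f x ^+ n : F).
Proof.
move=> cf; elim: n => [|n IH].
  by under eq_fun do rewrite expr0; move=> x; exact: cvg_cst.
under eq_fun do rewrite exprS.
apply: continuousM_num; [exact: cf|exact: IH].
Qed.

End continuous_num.

Section complex_numbers.
Variable R : realType.
Local Notation C := R[i].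

Lemma normc_ge0 (c : C) : 0 <= normc c.
Proof. by case: c => a b; exact: sqrtr_ge0. Qed.

Lemma normc_real (r : R) : normc (r%:C)%C = `|r|.
Proof. by rewrite /= expr0n addr0 sqrtr_sqr. Qed.

Lemma normcB (x y : C) : normc (x - y) = normc (y - x).
Proof. by rewrite -opprB normcN. Qed.

Lemma normc_sum (I : Type) (s : seq I) (F : I -> C) :
  normc (\sum_(i <- s) F i) <= \sum_(i <- s) normc (F i).
Proof.
elim: s => [|i s IH]; first by rewrite !big_nil normc0.
by rewrite !big_cons (le_trans (le_normcD _ _)) // lerD2l.
Qed.

Lemma ReD (x y : C) : complex.Re (x + y) = complex.Re x + complex.Re y.
Proof. by case: x; case: y. Qed.

Lemma ImD (x y : C) : complex.Im (x + y) = complex.Im x + complex.Im y.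
Proof. by case: x; case: y. Qed.

Lemma Re_sum (I : Type) (s : seq I) (F : I -> C) :
  complex.Re (\sum_(i <- s) F i) = \sum_(i <- s) complex.Re (F i).
Proof. exact: (big_morph _ ReD). Qed.

Lemma Im_sum (I : Type) (s : seq I) (F : I -> C) :
  complex.Im (\sum_(i <- s) F i) = \sum_(i <- s) complex.Im (F i).
Proof. exact: (big_morph _ ImD). Qed.

Lemma Re_le_normc (x : C) : complex.Re x <= normc x.
Proof.
case: x => a b /=; apply: le_trans (ler_norm _) _.
by rewrite -sqrtr_sqr ler_wsqrtr // lerDl sqr_ge0.
Qed.

(** For [g] nonzero the factor is its conjugate phase. It turns a bound on real parts over all
    rotations into a bound on the modulus. *)
Lemma normc_rotate (g : C) : exists2 l : C, normc l <= 1 & l * g = (normc g)%:C%C.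
Proof.
have [->|g0] := eqVneq g 0; first by exists 0; rewrite ?normc0 ?mul0r.
exists ((normc g)%:C%C / g); last by rewrite divfK.
rewrite normcM normcV normc_real ger0_norm ?normc_ge0 // divff //.
by apply: contra_neq g0 => /eq0_normc.
Qed.

(** The linear term in [s] gives the first-order condition at a nearest point. *)
Lemma normcB_sqr (y u : C) (s : R) :
  normc (y - s%:C%C * u) ^+ 2 =
  normc y ^+ 2 - 2 * s * complex.Re (y^*%C * u) + s ^+ 2 * normc u ^+ 2.
Proof.
case: y u => a b [c d] /=; rewrite !sqr_sqrtr ?addr_ge0 ?sqr_ge0 //.
ring.
Qed.

Lemma normc_sqr (y : C) : normc y ^+ 2 = complex.Re (y^*%C * y).
Proof. by case: y => a b /=; rewrite sqr_sqrtr ?addr_ge0 ?sqr_ge0 //; ring. Qed.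

Lemma normcE_norm (x : C) : `|x| = (normc x)%:C%C.
Proof. by []. Qed.

Lemma normc_continuous : continuous (@normc R).
Proof.
move=> x; have h : Filter (nbhs x) by exact: nbhs_filter.
apply/cvgrPdist_lt => e e0.
apply/nbhs_ballP; exists e%:C%C; first by rewrite /= ltcR.
move=> y; rewrite /ball_ /= normcE_norm ltcR.
apply: le_lt_trans.
have h1 := le_normcD (x - y) y; rewrite subrK in h1.
have h2 := le_normcD (y - x) x; rewrite subrK normcB in h2.
by rewrite ler_norml; apply/andP; split; lra.
Qed.

Lemma real_complex_continuous : continuous (fun x : R => x%:C%C : C).
Proof.
move=> x; have h : Filter (nbhs x) by exact: nbhs_filter.
apply/cvgrPdist_lt => e e0.
(* A positive element of [R[i]] is real, so it can serve as a radius in [R]. *)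
have eE : e = (complex.Re e)%:C%C by rewrite RRe_real// gtr0_real.
rewrite eE ltcR in e0.
apply/nbhs_ballP; exists (complex.Re e) => // y.
rewrite /ball_ /= /ball /= => hy.
by rewrite -rmorphB /= normcE_norm eE ltcR normc_real.
Qed.

Lemma meval_continuous d (p : {mpoly C[d]}) :
  continuous (fun z : 'rV[C]_d => p.@[z 0] : C).
Proof.
under eq_fun do rewrite mevalE.
apply: continuous_sum_num => m; apply: continuousM_num; first exact: cst_continuous.
by apply: continuous_prod_num => i; apply: continuous_exp_num; exact: coord_continuous.
Qed.

(** The disc is a closed part of the continuous image of the square of side [2 * r]. *)
Lemma compact_disc (r : R) : compact [set c : C | normc c <= r].
Proof.
have h : closed [set c : C | normc c <= r].
  apply: (@preimage_closed _ _ (@normc R) [set x | x <= r]); last exact: closed_le.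
  by move=> x _; exact: normc_continuous.
set f := fun x : R * R => (x.1%:C + 'i * x.2%:C)%C : C.
have cf : continuous f.
  apply: continuousD_num; last apply: continuousM_num.
  - move=> x; apply: continuous_comp; [exact: cvg_fst|exact: real_complex_continuous].
  - by move=> x; exact: cvg_cst.
  - move=> x; apply: continuous_comp; [exact: cvg_snd|exact: real_complex_continuous].
apply: (subclosed_compact h (B := f @` (`[-r,r] `*` `[-r,r]))).
  apply: continuous_compact; first exact: continuous_subspaceT.
  apply: compact_setX; exact: segment_compact.
move=> c /= cr; exists (complex.Re c, complex.Im c).
  rewrite /= !in_itv/= -!ler_norml.
  have nE : normc c ^+ 2 = complex.Re c ^+ 2 + complex.Im c ^+ 2.
    by case: (c) => a b /=; rewrite sqr_sqrtr // addr_ge0 ?sqr_ge0.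
  split; apply: le_trans cr; rewrite -(@ler_pXn2r _ 2) ?nnegrE ?normc_ge0 //;
    by rewrite real_normK ?num_real // nE ?lerDl ?lerDr sqr_ge0.
by rewrite /f /= -complexE.
Qed.

(** The entries range over any topological space, as tuples of points are also handled this way. *)
Lemma mx_coord_continuous (T : topologicalType) m n i j :
  continuous (fun M : 'M[T]_(m, n) => M i j).
Proof.
move=> M A /= MA; exists (fun k l => if (k == i) && (l == j) then A else setT).
  by move=> k l; case: ifP => [/andP[/eqP-> /eqP->]|_] //; exact: filterT.
by move=> N /(_ i j); rewrite !eqxx.
Qed.

End complex_numbers.

(** * Minimization of seminorms *)

Section seminorm_minimum.
Variable R : realType.
Local Notation C := R[i].

(** Homogeneity is an inequality, which is easy to check for a minimized seminorm; [seminormZ]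
    recovers equality by scaling back with the inverse. *)
Definition seminorm (V : lmodType C) (Q : V -> R) :=
  (forall u v, Q (u + v) <= Q u + Q v) /\
  (forall c v, Q (c *: v) <= normc c * Q v).

(** The linear span, built one vector at a time to match the induction of the minimization. *)
Fixpoint spanned (V : lmodType C) (s : seq V) : set V :=
  if s is b :: s' then [set x + c *: b | x in spanned s' & c in setT] else [set 0].

Section seminorm.
Variables (V : lmodType C) (Q : V -> R).
Hypothesis HQ : seminorm Q.

Lemma seminorm0 : Q 0 = 0.
Proof.
case: HQ => HD HZ; apply/eqP; rewrite eq_le; apply/andP; split.
  by have := HZ 0 0; rewrite scale0r normc0 mul0r.
by have := HD 0 0; rewrite addr0; lra.
Qed.

Lemma seminormN u : Q (- u) <= Q u.
Proof. by case: HQ => _ /(_ (-1) u); rewrite scaleN1r normcN normc1 mul1r. Qed.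

Lemma seminorm_ge0 u : 0 <= Q u.
Proof.
have := HQ.1 u (- u); rewrite subrr seminorm0 => h.
by have := seminormN u; lra.
Qed.

Lemma seminormZ c u : Q (c *: u) = normc c * Q u.
Proof.
apply/eqP; rewrite eq_le HQ.2 /=.
have [->|c0] := eqVneq c 0; first by rewrite normc0 mul0r seminorm_ge0.
have nc : 0 < normc c.
  by rewrite lt_neqAle normc_ge0 andbT eq_sym; apply: contra_neq c0 => /eq0_normc.
by have := HQ.2 c^-1 (c *: u); rewrite scalerA mulVf // scale1r normcV ler_pdivlMl.
Qed.

Lemma seminorm_min_line (v b : V) :
  exists c : C, forall c', Q (v + c *: b) <= Q (v + c' *: b).
Proof.
have [Qb0|Qb0] := eqVneq (Q b) 0.
  exists 0 => c'; rewrite scale0r addr0.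
  have := HQ.1 (v + c' *: b) (- c' *: b).
  by rewrite seminormZ Qb0 mulr0 addr0 -addrA -scalerDl subrr scale0r addr0.
have Qb : 0 < Q b by rewrite lt_neqAle eq_sym Qb0 seminorm_ge0.
(* If [normc c] exceeds [T], then [Q (v + c *: b)] is at least [normc c * Q b - Q v], hence above
   [Q v], the value at [c = 0]. Only a compact disc remains. *)
set T := 2 * Q v / Q b.
have T0 : 0 <= T by rewrite divr_ge0 ?seminorm_ge0 // mulr_ge0 ?seminorm_ge0.
have T0' : normc (0 : C) <= T by rewrite normc0.
have lipQ c c' : `|Q (v + c *: b) - Q (v + c' *: b)| <= normc (c - c') * Q b.
  have h x y : Q (v + x *: b) <= Q (v + y *: b) + normc (x - y) * Q b.
    rewrite -seminormZ (le_trans _ (HQ.1 _ _))//.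
    by rewrite -addrA -scalerDl [y + _]addrC subrK.
  have h1 := h c c'; have h2 := h c' c; rewrite normcB in h2.
  by rewrite ler_norml; apply/andP; split; lra.
have cQ : continuous (fun c : C => Q (v + c *: b)).
  move=> c; have h : Filter (nbhs c) by exact: nbhs_filter.
  apply/cvgrPdist_lt => e e0.
  apply/nbhs_ballP; exists ((e / Q b)%:C)%C; first by rewrite /= ltcR divr_gt0.
  move=> y; rewrite /ball_ /= normcE_norm ltcR ltr_pdivlMr // => hy.
  exact: le_lt_trans (lipQ _ _) hy.
have [||c cT cmin] := @compact_EVT_min _ R (fun c : C => Q (v + c *: b)) _ _ (@compact_disc R T).
  by exists 0.
  exact: continuous_subspaceT.
exists c => c'.
have [c'T|c'T] := leP (normc c') T; first by apply: cmin; rewrite inE.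
apply: (@le_trans _ _ (Q v)).
  have := cmin 0; rewrite scale0r addr0.
  by apply; rewrite inE.
have := HQ.1 (v + c' *: b) (- v); rewrite addrC addrA [- v + v]addrC subrr add0r seminormZ.
have := seminormN v.
by move: c'T; rewrite /T ltr_pdivrMr // => h1 h2 h3; lra.
Qed.

End seminorm.

(* By induction on the list: minimizing along b first leaves the quotient seminorm by C b. *)
Lemma seminorm_min (V : lmodType C) (Q : V -> R) (s : seq V) (v : V) :
  seminorm Q -> exists2 x, spanned s x & forall y, spanned s y -> Q (v + x) <= Q (v + y).
Proof.
elim: s Q => [|b s IH] Q HQ; first by exists 0 => // y ->.
have [c cmin] := choice (fun u => seminorm_min_line HQ u b).
have HQ' : seminorm (fun u => Q (u + c u *: b)).
  split=> [u w|a u].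
    (* Minimality is tested against the multiplier [c u + c w], and for scaling against
       [a * c u]. *)
    apply: le_trans (cmin _ (c u + c w)) _.
    by rewrite scalerDl addrACA; exact: HQ.1.
  apply: le_trans (cmin _ (a * c u)) _.
  by rewrite -scalerA -scalerDr; exact: HQ.2.
have [x xs xmin] := IH _ HQ'.
exists (x + c (v + x) *: b); first by exists x => //; exists (c (v + x)).
move=> _ [y ys [c' _ <-]]; rewrite !addrA.
exact: le_trans (xmin y ys) (cmin _ _).
Qed.

Lemma spanned_sum (V : lmodType C) (I : Type) (s : seq I) (a : I -> C) (b : I -> V) :
  spanned (map b s) (\sum_(i <- s) a i *: b i).
Proof.
elim: s => [|i s IH] /=; first by rewrite big_nil.
by rewrite big_cons addrC; exists (\sum_(j <- s) a j *: b j) => //; exists (a i).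
Qed.

Lemma spanned_ind (V : lmodType C) (I : Type) (s : seq I) (b : I -> V) (P : set V) :
  P 0 -> (forall c i x, P x -> P (x + c *: b i)) ->
  forall x, spanned (map b s) x -> P x.
Proof.
move=> P0 PD; elim: s => [|i s IH] x /=; first by move=> ->.
by move=> [y /IH Py [c _ <-]]; exact: PD.
Qed.

End seminorm_minimum.

(** * Absolutely convex hulls *)

Section absolutely_convex_hull.
Variable R : realType.
Local Notation C := R[i].

(** For positive [P] the quadratic is negative at [s = P / (P + U)], where [s * U = P - s * P]. *)
Lemma nonpos_of_quadratic (P U : R) : 0 <= U ->
  (forall s, 0 <= s <= 1 -> 0 <= - (2 * s * P) + s ^+ 2 * U) -> P <= 0.
Proof.
move=> U0 h; rewrite leNgt; apply/negP => P0.
have PU : 0 < P + U by lra.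
have s0 : 0 < P / (P + U) by rewrite divr_gt0.
have s1 : P / (P + U) <= 1 by rewrite ler_pdivrMr //; lra.
have sU : P / (P + U) * (P + U) = P by rewrite divfK // gt_eqF.
have := h (P / (P + U)); rewrite (ltW s0) s1 => /(_ isT).
move: s0 s1 sU; set s := P / _ => s0 s1 sU h'.
have sE : - (2 * s * P) + s ^+ 2 * U = s * (- (2 * P) + s * U) by ring.
move: h'; rewrite sE pmulr_rge0 //; have : 0 < s * P by rewrite mulr_gt0.
by move: sU; rewrite mulrDr; lra.
Qed.

(** Real and imaginary parts give [2 * #|I|] real equations in [k] unknowns, so the kernel is
    nonzero. *)
Lemma real_dependence (I : finType) k (v : 'I_k -> I -> C) :
  (2 * #|I| < k)%N ->
  exists2 r : 'I_k -> R, (exists i, r i != 0) &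
    forall j, \sum_i (r i)%:C%C * v i j = 0.
Proof.
move=> Ik.
pose A : 'M[R]_(k, #|{: I * bool}|) := \matrix_(i, l)
  let: (j, s) := enum_val l in if s then complex.Re (v i j) else complex.Im (v i j).
have kerA : kermx A != 0.
  rewrite -mxrank_eq0 mxrank_ker -lt0n subn_gt0.
  by rewrite (leq_ltn_trans (rank_leq_col A)) // card_prod card_bool mulnC.
have /rowV0Pn[r rA r0] := kerA.
have {}rA := sub_kermxP rA.
exists (r 0).
  apply/existsP; apply: contraNT r0; rewrite negb_exists => /forallP r0.
  by apply/eqP/rowP => i; rewrite mxE; apply/eqP; rewrite -[_ == _]negbK r0.
move=> j; apply/eqP; rewrite eq_complex Re_sum Im_sum; apply/andP; split; apply/eqP.
  have /rowP/(_ (enum_rank (j, true))) := rA; rewrite !mxE => /= {2}<-.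
  by apply: eq_bigr => i _; rewrite mxE enum_rankK; case: (v i j) => a b /=; rewrite mul0r subr0.
have /rowP/(_ (enum_rank (j, false))) := rA; rewrite !mxE => /= {2}<-.
by apply: eq_bigr => i _; rewrite mxE enum_rankK; case: (v i j) => a b /=; rewrite mul0r addr0.
Qed.

Section hull.
Variables (X : ptopologicalType) (I : finType) (K : set X) (e : I -> X -> C).

(** The number of terms is fixed so that coefficients and points range over a compact set. *)
Definition abshull k : set (I -> C) := [set x |
  exists (c : 'I_k -> C) (z : 'I_k -> X),
  [/\ forall i, K (z i), \sum_i normc (c i) <= 1 &
      forall j, x j = \sum_i c i * e j (z i)]].

Lemma abshull_drop k (x : I -> C) (c : 'I_k.+1 -> C) (z : 'I_k.+1 -> X) i0 :
  (forall i, K (z i)) -> \sum_i normc (c i) <= 1 ->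
  (forall j, x j = \sum_i c i * e j (z i)) -> c i0 = 0 -> abshull k x.
Proof.
move=> Kz c1 xE ci0; exists (c \o lift i0), (z \o lift i0); split => /=.
- by move=> i; exact: Kz.
- by move: c1; rewrite (bigD1_ord i0) //= ci0 normc0 add0r.
- by move=> j; rewrite xE (bigD1_ord i0) //= ci0 mul0r add0r.
Qed.

(** A real relation among the vectors [c i * e j (z i)] rescales the coefficients by real factors;
    these can be kept nonnegative while one of them vanishes. *)
Lemma abshull_caratheodory k : (2 * #|I| <= k)%N -> abshull k.+1 `<=` abshull k.
Proof.
move=> Ik x [c [z [Kz c1 xE]]].
have [r0 [i0 r0i0] r0E] := real_dependence (fun i j => c i * e j (z i)) Ik.
(* Up to sign, the relation can be subtracted without increasing the total mass. *)
have [r [[i1 ri1] rE rc]] : exists r : 'I_k.+1 -> R, [/\ exists i, r i != 0,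
    forall j, \sum_i (r i)%:C%C * (c i * e j (z i)) = 0 & 0 <= \sum_i r i * normc (c i)].
  have [h|h] := leP 0 (\sum_i r0 i * normc (c i)); first by exists r0; split => //; exists i0.
  exists (fun i => - r0 i); split.
  - by exists i0; rewrite oppr_eq0.
  - move=> j; under eq_bigr do rewrite rmorphN mulNr.
    by rewrite sumrN r0E oppr0.
  - under eq_bigr do rewrite mulNr.
    by rewrite sumrN oppr_ge0 ltW.
have [i2 _ i2max] := @Order.TotalTheory.arg_maxP _ _ _ i1 xpredT r isT.
(* If no [r i] is positive, the sign condition forces every [r i * normc (c i)] to vanish, so [c i1]
   is already zero. *)
have [ri2|ri2] := leP (r i2) 0.
  have rneg i : r i <= 0 by exact: le_trans (i2max i isT) ri2.
  have ci1 : r i1 * normc (c i1) == 0.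
    rewrite eq_le mulr_le0_ge0 ?normc_ge0 //=; apply: le_trans rc _.
    rewrite (bigD1 i1) //= gerDl sumr_le0 // => i _.
    by rewrite mulr_le0_ge0 ?normc_ge0.
  move: ci1; rewrite mulf_eq0 (negPf ri1) /= => /eqP /eq0_normc ci1.
  exact: abshull_drop Kz c1 xE ci1.
(* Subtracting the relation divided by its largest coefficient kills the term [i2]; maximality keeps
   the other factors nonnegative. *)
have s0 i : 0 <= 1 - r i / r i2.
  by rewrite subr_ge0 ler_pdivrMr // mul1r; exact: i2max.
apply: (@abshull_drop _ _ (fun i => (1 - r i / r i2)%:C%C * c i) z i2) => //.
- apply: le_trans c1; under eq_bigr => i _ do rewrite normcM normc_real ger0_norm //.
  under eq_bigr => i _ do rewrite mulrBl mul1r mulrAC.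
  by rewrite sumrB -mulr_suml gerBl divr_ge0 // ltW.
- move=> j; under eq_bigr => i _ do
    rewrite rmorphB rmorph1 rmorphM -mulrA mulrBl mul1r mulrAC.
  by rewrite sumrB -mulr_suml rE mul0r subr0.
- by rewrite divff ?gt_eqF // subrr mul0r.
Qed.

(** A step towards a rotated evaluation costs one more point: the old coefficients shrink by [1 - s]
    and the new one is [s * l]. *)
Lemma abshull_move k (x : I -> C) s l z : abshull k x -> 0 <= s <= 1 ->
  normc l <= 1 -> K z ->
  abshull k.+1 (fun j => x j + s%:C%C * (l * e j z - x j)).
Proof.
move=> [c [y [Ky c1 xE]]] /andP[s0 s1] l1 Kz.
exists (fun i => if unlift ord0 i is Some i' then (1 - s)%:C%C * c i' else s%:C%C * l).
exists (fun i => if unlift ord0 i is Some i' then y i' else z); split.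
- by move=> i; case: unlift.
- rewrite big_ord_recl unlift_none; under eq_bigr do rewrite liftK normcM normc_real.
  rewrite -mulr_sumr normcM normc_real !ger0_norm ?subr_ge0 //.
  have := ler_wpM2l s0 l1; have s1' : 0 <= 1 - s by lra.
  by have := ler_wpM2l s1' c1; lra.
- move=> j; rewrite big_ord_recl !unlift_none.
  under eq_bigr do rewrite liftK -mulrA.
  by rewrite -mulr_sumr -xE rmorphB rmorph1; ring.
Qed.

Hypotheses (cK : compact K) (K0 : K !=set0) (ce : forall j, continuous (e j)).

Lemma abshull_nearest k (b : I -> C) : exists2 x, abshull k x &
  forall y, abshull k y ->
    \sum_j normc (b j - x j) ^+ 2 <= \sum_j normc (b j - y j) ^+ 2.
Proof.
(* The polydisc supplies compactness, and the mass condition cuts out a closed part of it. *)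
pose A := ([set c : 'rV[C]_k | forall i, normc (c 0 i) <= 1]
   `&` [set c : 'rV[C]_k | \sum_i normc (c 0 i) <= 1])
   `*` [set z : 'rV[X]_k | forall i, K (z 0 i)].
pose x_ (v : 'rV[C]_k * 'rV[X]_k) j : C := \sum_i v.1 0 i * e j (v.2 0 i).
pose f v : R := \sum_j normc (b j - x_ v j) ^+ 2.
have cA : compact A.
  apply: compact_setX; last exact: (@rV_compact _ _ (fun=> K)).
  apply: compact_closedI.
    apply: (@rV_compact _ _ (fun=> [set c : C | normc c <= 1])) => _.
    exact: compact_disc.
  apply: (@preimage_closed _ _ (fun v : 'rV[C]_k => \sum_i normc (v 0 i))
    [set x : R | x <= 1]); last exact: closed_le.
  move=> v _; apply: continuous_sum_num => i {}v.
  by apply: continuous_comp; [exact: mx_coord_continuous|exact: normc_continuous].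
have cx j : continuous (x_^~ j).
  apply: continuous_sum_num => i; apply: continuousM_num => v.
    apply: (@continuous_comp _ _ _ fst (fun c : 'rV[C]_k => c 0 i)); first exact: cvg_fst.
    exact: mx_coord_continuous.
  apply: (@continuous_comp _ _ _ (fun v : 'rV[C]_k * 'rV[X]_k => v.2 0 i)).
    apply: (@continuous_comp _ _ _ snd (fun z : 'rV[X]_k => z 0 i)); first exact: cvg_snd.
    exact: mx_coord_continuous.
  exact: ce.
have cf : continuous f.
  apply: continuous_sum_num => j; apply: continuous_exp_num => v.
  apply: (@continuous_comp _ _ _ (fun v => b j - x_ v j) (@normc R)).
    by apply: cvgB; [exact: cst_continuous|exact: cx].
  exact: normc_continuous.
have [z0 Kz0] := K0.
have [||[u w] /set_mem [[_ /= u1] wK] vmin] := @compact_EVT_min _ R f A _ cA.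
- exists (const_mx 0, const_mx z0); split => /=; [split|].
  + by move=> i /=; rewrite mxE normc0.
  + by rewrite /=; under eq_bigr do rewrite mxE normc0; rewrite big1.
  + by move=> i; rewrite mxE.
- exact: continuous_subspaceT.
exists (x_ (u, w)); first by exists (u 0), (w 0).
move=> y [c [z [Kz cle yE]]].
have -> : \sum_j normc (b j - y j) ^+ 2 = f (\row_i c i, \row_i z i).
  apply: eq_bigr => j _; rewrite yE /x_.
  by congr (normc (_ - _) ^+ 2); apply: eq_bigr => i _; rewrite !mxE.
apply: vmin; rewrite inE; split => /=; [split|] => /=.
- move=> i; rewrite mxE; apply: le_trans cle.
  by rewrite (bigD1 i) //= lerDl sumr_ge0 // => ? _; exact: normc_ge0.
- by under eq_bigr do rewrite mxE.
- by move=> i; rewrite mxE.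
Qed.

(* The nearest point x of the hull to b satisfies Re <b - x, y - x> <= 0 for all y in the
   hull, so a = conj (b - x) would separate b from the hull if x were not b. *)
Lemma abshull_bipolar (b : I -> C) :
  (forall (a : I -> C) (M : R),
     (forall z, K z -> normc (\sum_j a j * e j z) <= M) ->
     normc (\sum_j a j * b j) <= M) ->
  abshull (2 * #|I|) b.
Proof.
move=> Hb; have [x Hx xmin] := abshull_nearest (2 * #|I|) b.
pose a j := ((b j - x j)^*)%C.
have var l z : normc l <= 1 -> K z ->
    complex.Re (\sum_j a j * (l * e j z - x j)) <= 0.
  move=> l1 Kz; rewrite Re_sum.
  apply: (nonpos_of_quadratic (U := \sum_j normc (l * e j z - x j) ^+ 2)).
    by rewrite sumr_ge0 // => j _; rewrite sqr_ge0.
  (* The extra point is removed by Caratheodory, so the moved vector still competes with [x]. *)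
  move=> s s01; have := xmin _ (abshull_caratheodory (leqnn _) (abshull_move Hx s01 l1 Kz)).
  under [X in _ <= X]eq_bigr do rewrite opprD addrA normcB_sqr.
  rewrite !big_split /= sumrN -!mulr_sumr; lra.
(* The rotation [l] makes the pairing with [e] equal to its modulus. The resulting bound is the [M]
   for which [Hb] is used. *)
have aM z : K z -> normc (\sum_j a j * e j z) <= complex.Re (\sum_j a j * x j).
  move=> Kz; have [l l1 lE] := normc_rotate (\sum_j a j * e j z).
  have := var l z l1 Kz.
  under eq_bigr do rewrite mulrBr mulrCA.
  rewrite sumrB -mulr_sumr lE ReD.
  by case: (\sum_j a j * x j) => u w /=; lra.
(* By the choice of [a] this real part is the squared distance from [b] to [x], which therefore
   vanishes. *)
have : complex.Re (\sum_j a j * (b j - x j)) <= 0.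
  under eq_bigr do rewrite mulrBr.
  rewrite sumrB ReD; have := le_trans (Re_le_normc _) (Hb a _ aM).
  by case: (\sum_j a j * x j) => u w /=; lra.
rewrite Re_sum; under eq_bigr do rewrite -normc_sqr.
move=> s0.
have /psumr_eq0P h : forall j, true -> 0 <= normc (b j - x j) ^+ 2 by move=> j _; exact: sqr_ge0.
suff -> : b = x by [].
apply/funext => j; apply/eqP; rewrite -subr_eq0; apply/eqP/eq0_normc/eqP.
rewrite -sqrf_eq0; apply/eqP/h => //; apply/eqP; rewrite eq_le s0 sumr_ge0 // => i _.
exact: sqr_ge0.
Qed.
End hull.

End absolutely_convex_hull.

(** * Polynomials on a compact set *)

Section polynomials.
Variables (R : realType) (d : nat).
Local Notation C := R[i].
Implicit Types (p q : {mpoly C[d]}) (z : 'rV[C]_d).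

Lemma polyabs_ge0 p z : 0 <= polyabs p z.
Proof. exact: normc_ge0. Qed.

Lemma polyabsZ c p z : polyabs (c *: p) z = normc c * polyabs p z.
Proof. by rewrite /polyabs mevalZ normcM. Qed.

Lemma polyabsD p q z : polyabs (p + q) z <= polyabs p z + polyabs q z.
Proof. by rewrite /polyabs mevalD le_normcD. Qed.

Lemma polyabs_eq0 p z : (polyabs p z == 0) = (p.@[z 0] == 0).
Proof.
apply/eqP/eqP => [/eq0_normc//|p0].
by rewrite /polyabs p0 normc0.
Qed.

Lemma polyabs_continuous p : continuous (polyabs p).
Proof.
move=> z; apply: (@continuous_comp _ _ _ (fun z : 'rV[C]_d => p.@[z 0] : C) (@normc R)).
  exact: meval_continuous.
exact: normc_continuous.
Qed.

Lemma poly_deg_leD n p q : poly_deg_le n p -> poly_deg_le n q -> poly_deg_le n (p + q).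
Proof.
rewrite /poly_deg_le /= => hp hq; apply: leq_trans (msizeD_le _ _) _.
by rewrite geq_max hp.
Qed.

Lemma poly_deg_leZ n c p : poly_deg_le n p -> poly_deg_le n (c *: p).
Proof. exact: leq_trans (msizeZ_le _ _). Qed.

Lemma poly_deg_le1 n : poly_deg_le n (1 : {mpoly C[d]}).
Proof. by rewrite /poly_deg_le /= msize1. Qed.

(* Dividing by p(z0) reduces the maximization of |p(z0)| / Q p to the minimization of Q over
   the affine space of the p with p(z0) = 1, which is 1 + the span of the X^m - z0^m. *)
Lemma seminorm_extremal n (z0 : 'rV[C]_d) (Q : {mpoly C[d]} -> R) : seminorm Q ->
  exists p, [/\ poly_deg_le n p, p.@[z0 0] = 1 &
    forall q, poly_deg_le n q -> polyabs q z0 * Q p <= Q q].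
Proof.
move=> HQ.
pose b (m : 'X_{1..d < n.+1}) : {mpoly C[d]} := 'X_[m] - ('X_[m]).@[z0 0] *: 1.
have [x xs xmin] := seminorm_min (map b (index_enum _)) 1 HQ.
have [xn x0] : poly_deg_le n x /\ x.@[z0 0] = 0.
  move: x xs {xmin}; apply: spanned_ind; first by rewrite /poly_deg_le /= msize0 meval0.
  move=> c m p [pn p0]; split; last first.
    by rewrite mevalD p0 add0r mevalZ mevalB mevalZ meval1 mulr1 subrr mulr0.
  apply: poly_deg_leD => //; apply: poly_deg_leZ; rewrite /b -scaleNr.
  apply: poly_deg_leD; first by rewrite /poly_deg_le /= msizeX bmdeg.
  by apply: poly_deg_leZ; exact: poly_deg_le1.
exists (1 + x); split.
- by apply: poly_deg_leD => //; exact: poly_deg_le1.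
- by rewrite mevalD meval1 x0 addr0.
move=> q qn; have [q0|q0] := eqVneq (q.@[z0 0]) 0.
  by rewrite /polyabs q0 normc0 mul0r seminorm_ge0.
set c := q.@[z0 0] in q0 *.
(* In the monomial expansion of [c^-1 *: q] the constants subtracted in the [b m] add up to
   [c^-1 * c = 1]. *)
have h : spanned (map b (index_enum _)) (c^-1 *: q - 1).
  have -> : c^-1 *: q - 1 = \sum_(m : 'X_{1..d < n.+1}) (c^-1 * q@_m) *: b m.
    have qE := mpolywE qn.
    rewrite {1}qE scaler_sumr.
    under [RHS]eq_bigr do rewrite scalerBr scalerA -mulrA.
    rewrite sumrB; congr (_ - _).
      by apply: eq_bigr => m _; rewrite scalerA.
    rewrite -scaler_suml -mulr_sumr.
    have -> : \sum_(m : 'X_{1..d < n.+1}) q@_m * ('X_[m] : {mpoly C[d]}).@[z0 0] = c.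
      rewrite /c {2}qE raddf_sum /=.
      by apply: eq_bigr => m _; rewrite mevalZ.
    by rewrite mulVf // scale1r.
  exact: spanned_sum.
have := xmin _ h; rewrite [1 + (_ - _)]addrC subrK (seminormZ HQ) normcV.
rewrite ler_pdivlMl //.
by rewrite lt_neqAle normc_ge0 andbT eq_sym -/(polyabs q z0) polyabs_eq0.
Qed.

Section sup.
Variable K : set 'rV[C]_d.
Hypotheses (cK : compact K) (Kdet : polynomial_determining K).

Lemma polynomial_determining_nonempty : K !=set0.
Proof.
apply/set0P/eqP => K0.
have /eqP : (1 : {mpoly C[d]}) = 0 by apply: Kdet; rewrite K0.
by rewrite oner_eq0.
Qed.

Lemma polyabs_has_sup p : has_sup [set polyabs p z | z in K].
Proof.
have K0 := polynomial_determining_nonempty.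
apply: compact_has_sup; first exact: image_nonempty.
by apply: continuous_compact => //; apply: continuous_subspaceT; exact: polyabs_continuous.
Qed.

Lemma polyabs_le_supnorm p z : K z -> polyabs p z <= supnorm K p.
Proof. by move=> Kz; apply: (sup_upper_bound (polyabs_has_sup p)); exists z. Qed.

Lemma supnorm_le p M : (forall z, K z -> polyabs p z <= M) -> supnorm K p <= M.
Proof.
move=> pM; apply: ge_sup; first exact: (polyabs_has_sup p).1.
by move=> _ [z Kz <-]; exact: pM.
Qed.

Lemma supnorm_seminorm : seminorm (supnorm K).
Proof.
split=> [p q|c p]; apply: supnorm_le => z Kz.
  by apply: le_trans (polyabsD _ _ _) _; rewrite lerD ?polyabs_le_supnorm.
by rewrite polyabsZ ler_wpM2l ?normc_ge0 ?polyabs_le_supnorm.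
Qed.

Lemma supnorm_gt0 p : p != 0 -> 0 < supnorm K p.
Proof.
move=> p0; rewrite lt_neqAle (seminorm_ge0 supnorm_seminorm) andbT eq_sym.
apply: contra p0 => /eqP s0; apply/eqP/Kdet => z Kz.
apply/eqP; rewrite -polyabs_eq0 eq_le polyabs_ge0 andbT -s0.
exact: polyabs_le_supnorm.
Qed.
End sup.

End polynomials.

(** * Mean squares *)

Section real_inequalities.
Variable R : realType.

(** This yields Minkowski's inequality in L^2 from an integrated Young inequality: the infimum over
    [t] of the right-hand side is the square of the sum of the roots. *)
Lemma sqrt_subadditive_of_young (u v w : R) : 0 <= u -> 0 <= v -> 0 <= w ->
  (forall t, 0 < t -> w <= (1 + t) * u + (1 + t^-1) * v) ->
  Num.sqrt w <= Num.sqrt u + Num.sqrt v.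
Proof.
move=> u0 v0 w0 young.
(* t is the ratio of the two roots; e keeps it well defined *)
apply/ler_addgt0Pr => e e0.
have := sqr_sqrtr u0; have := sqr_sqrtr v0.
have := sqrtr_ge0 u; have := sqrtr_ge0 v.
set a := Num.sqrt u; set b := Num.sqrt v => b0 a0 b2 a2.
have A0 : 0 < a + e / 2 by lra.
have B0 : 0 < b + e / 2 by lra.
set A := a + e / 2 in A0; set B := b + e / 2 in B0.
have -> : a + b + e = A + B by rewrite /A /B; lra.
have AB0 : 0 <= A + B by lra.
rewrite -(@ler_sqr _ (Num.sqrt _)) ?nnegrE ?sqrtr_ge0 // sqr_sqrtr //.
apply: le_trans (young _ (divr_gt0 B0 A0)) _; rewrite -a2 -b2 invf_div.
have -> : (A + B) ^+ 2 = (1 + B / A) * A ^+ 2 + (1 + A / B) * B ^+ 2.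
  by field; rewrite !gt_eqF.
have AB : 0 < B / A by rewrite divr_gt0.
have BA : 0 < A / B by rewrite divr_gt0.
have aA : a <= A by rewrite /A; lra.
have bB : b <= B by rewrite /B; lra.
by apply: lerD; apply: ler_wpM2l; rewrite ?addr_ge0 ?ler_sqr ?nnegrE // ltW.
Qed.

(** If [u] is zero the right-hand side is [+oo]; otherwise [v] is positive too and both quotients
    are real. *)
Lemma sqr_ratio_le (a u v : R) : 0 < a -> 0 <= u -> 0 <= v ->
  a * Num.sqrt u <= Num.sqrt v -> ((a ^+ 2)%:E / v%:E <= 1 / u%:E)%E.
Proof.
move=> a0 u0 v0 auv; rewrite mul1e.
have [->|un0] := eqVneq u 0; first by rewrite inve0 leey.
have up : 0 < u by rewrite lt_neqAle eq_sym un0.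
have auv2 : a ^+ 2 * u <= v.
  rewrite -(sqr_sqrtr u0) -(sqr_sqrtr v0) -exprMn ler_sqr // nnegrE ?sqrtr_ge0 //.
  by rewrite mulr_ge0 ?sqrtr_ge0 // ltW.
have vp : 0 < v by apply: lt_le_trans auv2; rewrite mulr_gt0 ?exprn_gt0.
rewrite !inver !gt_eqF // -EFinM lee_fin.
by rewrite ler_pdivrMr // mulrC ler_pdivlMr.
Qed.

(** This is the nonnegativity of the variance of [y] under the weights [w]. *)
Lemma sqr_sum_le (k : nat) (w y : 'I_k -> R) : (forall i, 0 <= w i) ->
  \sum_i w i = 1 -> (\sum_i w i * y i) ^+ 2 <= \sum_i w i * y i ^+ 2.
Proof.
move=> w0 w1; set m := \sum_i w i * y i.
have : 0 <= \sum_i w i * (y i - m) ^+ 2.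
  by apply: sumr_ge0 => i _; rewrite mulr_ge0 ?sqr_ge0.
have -> : \sum_i w i * (y i - m) ^+ 2 =
    \sum_i (w i * y i ^+ 2 + (w i * y i) * (- 2 * m) + w i * m ^+ 2).
  by apply: eq_bigr => i _; ring.
rewrite !big_split /= -!mulr_suml w1 -/m; lra.
Qed.

End real_inequalities.

Section mean_squares.
Variables (R : realType) (d : nat).
Local Notation C := R[i].
Implicit Types (p q : {mpoly C[d]}) (z : 'rV[C]_d).

Lemma rV_hausdorff : hausdorff_space 'rV[C]_d.
Proof.
move=> u v uv; apply/rowP => i.
apply: (@norm_hausdorff _ C) => P Q Pu Qv.
have cont := @mx_coord_continuous C 1 d 0 i.
have [w [Pw Qw]] := uv _ _ (cont u P Pu) (cont v Q Qv).
by exists (w 0 i).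
Qed.

Lemma continuous_borel_measurable (f : 'rV[C]_d -> R) :
  continuous f -> measurable_fun setT (f : borelC R d -> R).
Proof.
move=> /continuousP cf; apply: (measurability _ (RGenOpens.measurableE R)).
move=> _ [_ [a [b ->]] <-]; rewrite setTI.
by apply: sub_sigma_algebra; exact/cf/interval_open.
Qed.

Lemma compact_borel_measurable (K : set 'rV[C]_d) : compact K ->
  measurable (K : set (borelC R d)).
Proof.
move=> cK; rewrite -[K]setCK; apply: measurableC; apply: sub_sigma_algebra.
by rewrite openC; apply: compact_closed => //; exact: rV_hausdorff.
Qed.

Section mean_square.
Variables (K : set 'rV[C]_d) (mu : probability (borelC R d) R).
Hypotheses (cK : compact K) (Kdet : polynomial_determining K) (muK : prob_on K mu).

Let mK : measurable (K : set (borelC R d)) := compact_borel_measurable cK.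

Lemma sqr_polyabs_measurable (D : set (borelC R d)) p :
  measurable_fun D (fun z : borelC R d => polyabs p z ^+ 2 : R).
Proof.
apply: measurable_funTS; apply: continuous_borel_measurable => z.
by apply: continuous_exp_num; exact: polyabs_continuous.
Qed.

(** [fine] loses nothing: the integral is at most the squared supremum norm because [K] has mass
    1. *)
Definition mean_square p : R := fine (\int[mu]_(z in K) (polyabs p z ^+ 2)%:E).

Lemma mean_square_ge0 p : 0 <= mean_square p.
Proof. by apply/fine_ge0/integral_ge0 => z _; rewrite lee_fin sqr_ge0. Qed.

Let mp2 p : measurable_fun (K : set (borelC R d)) (fun z => (polyabs p z ^+ 2)%:E).
Proof.
have h := @measurable_EFinP _ (borelC R d) R K (fun z => polyabs p z ^+ 2).
exact: (h.2 (sqr_polyabs_measurable p)).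
Qed.

Let mean_square_lee p :
  (\int[mu]_(z in K) (polyabs p z ^+ 2)%:E <= (supnorm K p ^+ 2)%:E)%E.
Proof.
have -> : ((supnorm K p ^+ 2)%:E = \int[mu]_(z in K) (cst (supnorm K p ^+ 2)%:E) z)%E.
  rewrite integral_cst // -[LHS]mule1; congr (_ * _)%E; exact: (esym muK).
apply: ge0_le_integral => //.
- by move=> z _; rewrite lee_fin sqr_ge0.
- move=> z Kz; rewrite lee_fin /cst ler_sqr ?nnegrE ?polyabs_ge0 ?polyabs_le_supnorm //.
  exact: seminorm_ge0 (supnorm_seminorm cK Kdet) p.
Qed.

Lemma mean_squareE p : (\int[mu]_(z in K) (polyabs p z ^+ 2)%:E = (mean_square p)%:E)%E.
Proof.
rewrite fineK // ge0_fin_numE; first exact: le_lt_trans (mean_square_lee p) (ltry _).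
by apply: integral_ge0 => z _; rewrite lee_fin sqr_ge0.
Qed.

Lemma mean_square_le_supnorm p : mean_square p <= supnorm K p ^+ 2.
Proof. by rewrite -lee_fin -mean_squareE; exact: mean_square_lee. Qed.

Lemma mean_squareZ c p : mean_square (c *: p) = normc c ^+ 2 * mean_square p.
Proof.
have : (\int[mu]_(z in K) (polyabs (c *: p) z ^+ 2)%:E =
    (normc c ^+ 2)%:E * \int[mu]_(z in K) (polyabs p z ^+ 2)%:E)%E.
  rewrite -ge0_integralZl_EFin ?sqr_ge0 //.
    by apply: eq_integral => z _; rewrite polyabsZ exprMn.
  by move=> z _; rewrite lee_fin sqr_ge0.
by rewrite !mean_squareE -EFinM; exact: EFin_inj.
Qed.

Lemma mean_squareD_young t p q : 0 < t ->
  mean_square (p + q) <= (1 + t) * mean_square p + (1 + t^-1) * mean_square q.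
Proof.
(* p + q is generalized lest unification unfold the addition of polynomials. *)
move: (p + q) (polyabsD p q) => r pqr t0.
have ti0 : 0 < t^-1 by rewrite invr_gt0.
have t1 : 0 <= 1 + t by lra.
have t2 : 0 <= 1 + t^-1 by lra.
have ge0 (s : R) u : 0 <= s -> forall z, K z -> (0 <= s%:E * (polyabs u z ^+ 2)%:E)%E.
  by move=> s0 z _; rewrite -EFinM lee_fin mulr_ge0 ?sqr_ge0.
suff : (\int[mu]_(z in K) (polyabs r z ^+ 2)%:E <=
    (1 + t)%:E * (\int[mu]_(z in K) (polyabs p z ^+ 2)%:E)
    + (1 + t^-1)%:E * (\int[mu]_(z in K) (polyabs q z ^+ 2)%:E))%E.
  by rewrite !mean_squareE -!EFinM -EFinD lee_fin.
rewrite -!ge0_integralZl_EFin //; try by move=> z _; rewrite lee_fin sqr_ge0.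
rewrite -ge0_integralD //; try exact: ge0; try exact: measurable_funeM.
apply: ge0_le_integral => //.
- by move=> z _; rewrite lee_fin sqr_ge0.
- by apply: emeasurable_funD; exact: measurable_funeM.
move=> z _; rewrite -!EFinM -EFinD lee_fin.
have := polyabs_ge0 r z; have := pqr z.
set a := polyabs p z; set b := polyabs q z; set c := polyabs _ z => h c0.
have cab : c ^+ 2 <= (a + b) ^+ 2 by rewrite ler_sqr ?nnegrE // (le_trans c0 h).
apply: le_trans cab _.
(* This square is the gap between the two sides of Young's inequality. *)
have : 0 <= t * (a - t^-1 * b) ^+ 2 by rewrite mulr_ge0 ?sqr_ge0 // ltW.
have -> : t * (a - t^-1 * b) ^+ 2 =
    t * a ^+ 2 - 2 * (t * t^-1) * a * b + (t * t^-1) * t^-1 * b ^+ 2 by ring.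
rewrite divff ?gt_eqF //; lra.
Qed.

Lemma root_mean_square_seminorm : seminorm (fun p => Num.sqrt (mean_square p)).
Proof.
split=> [p q|c p]; last first.
  by rewrite mean_squareZ sqrtrM ?sqr_ge0 // sqrtr_sqr ger0_norm ?normc_ge0.
apply: sqrt_subadditive_of_young; try exact: mean_square_ge0.
by move=> t; exact: mean_squareD_young.
Qed.

(** The maximizer is the extremal polynomial of the L^2 seminorm; if its mean square is zero, the
    maximum is [+oo]. *)
Lemma prediction_variance_is_max n z0 :
  is_max (variance_ratios n K mu z0) (prediction_variance n K mu z0).
Proof.
have [p [pn p1 pmax]] := seminorm_extremal n z0 root_mean_square_seminorm.
have pr : variance_ratios n K mu z0 (variance_ratio K mu z0 p).
  by exists p => //; split => //; rewrite p1 oner_neq0.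
have ub : ubound (variance_ratios n K mu z0) (variance_ratio K mu z0 p).
  move=> _ [q [qn q0] <-]; rewrite /variance_ratio !mean_squareE.
  have p0 : polyabs p z0 = 1 by rewrite /polyabs p1 normc1.
  rewrite p0 expr1n; apply: sqr_ratio_le; try exact: mean_square_ge0.
    by rewrite lt_neqAle polyabs_ge0 andbT eq_sym polyabs_eq0.
  exact: pmax.
have -> : prediction_variance n K mu z0 = variance_ratio K mu z0 p.
  apply/eqP; rewrite eq_le; apply/andP; split; first exact: ge_ereal_sup.
  exact: ereal_sup_ubound.
by split.
Qed.
End mean_square.

End mean_squares.

(** * Discrete probability measures *)

Section discrete.
Context d (T : measurableType d) (R : realType) (k : nat).
Variables (w : 'I_k -> {nonneg R}) (x : 'I_k -> T).

(** [msum] takes a family indexed by [nat]; indices from [k] on get the zero measure. *)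
Let atom (i : nat) : {measure set T -> \bar R} :=
  if insub i is Some j then mscale (w j) \d_(x j) else mzero.

(* The proof that the masses add up to 1 is an argument so that the probability structure can
   be inferred from the term. *)
Definition discrete_probability (_ : \sum_i (w i)%:num = 1) : set T -> \bar R :=
  msum atom k.

Hypothesis w1 : \sum_i (w i)%:num = 1.

HB.instance Definition _ := Measure.copy (discrete_probability w1) (msum atom k).

Lemma discrete_probabilityE A :
  discrete_probability w1 A = (\sum_i (w i)%:num * (x i \in A)%:R)%:E.
Proof.
rewrite /discrete_probability /msum -sumEFin; apply: eq_bigr => i _.
by rewrite /atom valK /= /mscale /= /dirac indicE EFinM.
Qed.

Let discrete_probability_setT : discrete_probability w1 setT = 1%E.
Proof.
rewrite discrete_probabilityE; congr EFin; rewrite -[RHS]w1; apply: eq_bigr => i _.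
by rewrite in_setT mulr1.
Qed.

HB.instance Definition _ :=
  Measure_isProbability.Build _ _ _ (discrete_probability w1) discrete_probability_setT.

Lemma integral_discrete_probability D (f : T -> R) : measurable D ->
  measurable_fun D f -> (forall i, D (x i)) -> (forall y, 0 <= f y) ->
  (\int[discrete_probability w1]_(y in D) (f y)%:E = (\sum_i (w i)%:num * f (x i))%:E)%E.
Proof.
move=> mD mf Dx f0.
have f0' y : D y -> (0 <= (f y)%:E)%E by rewrite lee_fin.
have mf' : measurable_fun D (EFin \o f) by exact/measurable_EFinP.
rewrite (ge0_integral_measure_sum atom mD f0' mf') -sumEFin.
apply: eq_bigr => i _; rewrite /atom valK ge0_integral_mscale // integral_dirac //.
by rewrite diracE mem_set // mul1e EFinM.
Qed.
End discrete.

(** * Construction of an optimal measure *)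

Section optimal_measure.
Variables (R : realType) (d n : nat).
Local Notation C := R[i].
Variables (K : set 'rV[C]_d) (z0 : 'rV[C]_d).
Hypotheses (cK : compact K) (Kdet : polynomial_determining K).

(* M q(z0) is an absolutely convex combination of values q(z_i), z_i in K; the moduli of
   its coefficients, completed to total mass 1, are the weights of the measure. *)
Lemma optimal_probability (M : R) : 0 <= M ->
  (forall q, poly_deg_le n q -> polyabs q z0 * M <= supnorm K q) ->
  exists2 mu : probability (borelC R d) R, prob_on K mu &
    forall q, poly_deg_le n q -> (polyabs q z0 * M) ^+ 2 <= mean_square K mu q.
Proof.
move=> M0 HM.
pose J : finType := 'X_{1..d < n.+1}.
pose e (m : J) (z : 'rV[C]_d) : C := ('X_[m] : {mpoly C[d]}).@[z 0].
have evE (a : J -> C) z : \sum_m a m * e m z = (\sum_m a m *: 'X_[m] : {mpoly C[d]}).@[z 0].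
  by rewrite raddf_sum /=; apply: eq_bigr => m _; rewrite mevalZ.
have K0 := polynomial_determining_nonempty Kdet.
have [k [c [z [Kz c1 cE]]]] : exists k, abshull K e k (fun m => M%:C%C * e m z0).
  exists (2 * #|J|)%N; apply: abshull_bipolar => //.
    by move=> m; exact: meval_continuous.
  (* The coefficients [a] define a polynomial of degree at most [n], to which [HM] applies. *)
  move=> a M' aM'.
  under eq_bigr do rewrite mulrCA.
  rewrite -mulr_sumr evE normcM normc_real ger0_norm // mulrC.
  apply: le_trans (HM _ _) _.
    rewrite /poly_deg_le /=; apply: leq_trans (msize_sum _ _ _) _.
    apply/bigmax_leqP => m _; apply: leq_trans (msizeZ_le _ _) _.
    by rewrite msizeX bmdeg.
  by apply: supnorm_le => // y Ky; rewrite /polyabs -evE; exact: aM'.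
have [z1 Kz1] := K0.
(* The additional index [ord0] carries the missing mass, placed at an arbitrary point [z1] of
   [K]. *)
pose wr i := if unlift ord0 i is Some j then normc (c j) else 1 - \sum_j normc (c j).
pose x i : borelC R d := if unlift ord0 i is Some j then z j else z1.
have wr0 (i : 'I_k.+1) : 0 <= wr i.
  by rewrite /wr; case: unlift => [j|]; rewrite ?normc_ge0 ?subr_ge0.
have wrE (y : 'I_k.+1 -> R) : \sum_i wr i * y i =
    (1 - \sum_j normc (c j)) * y ord0 + \sum_j normc (c j) * y (lift ord0 j).
  rewrite big_ord_recl {1}/wr unlift_none; congr (_ + _).
  by apply: eq_bigr => j _; rewrite /wr liftK.
pose w (i : 'I_k.+1) : {nonneg R} := NngNum (wr0 i).
have w1 : \sum_i (w i)%:num = 1.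
  have := wrE (fun=> 1); under eq_bigr do rewrite mulr1.
  by move=> /= ->; under [X in _ + X]eq_bigr do rewrite mulr1; rewrite mulr1 subrK.
have Kx i : K (x i) by rewrite /x; case: unlift.
exists (discrete_probability x w1).
  rewrite /prob_on /= discrete_probabilityE; congr EFin; rewrite -[RHS]w1.
  by apply: eq_bigr => i _; rewrite mem_set ?mulr1.
move=> q qn; rewrite /mean_square integral_discrete_probability //=; last first.
- by move=> y; exact: sqr_ge0.
- exact: sqr_polyabs_measurable.
- exact: compact_borel_measurable.
apply: le_trans (sqr_sum_le _ wr0 w1).
rewrite ler_sqr ?nnegrE ?mulr_ge0 ?polyabs_ge0 //; last first.
  by apply: sumr_ge0 => i _; rewrite mulr_ge0 ?polyabs_ge0.
have -> : polyabs q z0 * M = normc (\sum_i c i * q.@[z i 0]).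
  rewrite -[M]ger0_norm // -normc_real mulrC -normcM; congr normc.
  have qE := mpolywE qn.
  rewrite [in LHS]qE -evE mulr_sumr.
  transitivity (\sum_(m : J) q@_m * (\sum_i c i * e m (z i))).
    by apply: eq_bigr => m _; rewrite mulrCA cE.
  under eq_bigr do rewrite mulr_sumr.
  rewrite exchange_big /=; apply: eq_bigr => i _.
  rewrite [in RHS]qE -evE mulr_sumr.
  by apply: eq_bigr => m _; rewrite mulrCA.
apply: le_trans (normc_sum _ _) _.
rewrite wrE; under eq_bigr do rewrite normcM.
(* The additional atom contributes a nonnegative term, which is dropped. *)
rewrite ler_wpDl // ?mulr_ge0 ?subr_ge0 ?polyabs_ge0 //.
by apply: ler_sum => j _; rewrite /x liftK.
Qed.
End optimal_measure.

Unset Implicit Arguments.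

Theorem mainTheorem2 (R : realType) (d n : nat)
    (K : set 'rV[R[i]]_d) (z0 : 'rV[R[i]]_d)
    (Kcompact : compact K) (Kdet : polynomial_determining K)
    (z0K : ~ K z0) :
  (forall mu : probability (borelC R d) R, prob_on K mu ->
    is_max (variance_ratios n K mu z0) (prediction_variance n K mu z0)) /\
  exists m : R,
    [/\ is_min [set prediction_variance n K mu z0 | mu in prob_on K] m%:E,
        is_max [set polyabs p z0 ^+ 2 / supnorm K p ^+ 2 | p in
                 [set p | poly_deg_le n p /\ p != 0]] m &
        exists2 a : R,
          is_max [set polyabs p z0 | p in
                   [set p | poly_deg_le n p /\ supnorm K p <= 1]] a
          & m = a ^+ 2].
Proof.
split; first by move=> mu muK; exact: prediction_variance_is_max.
have supQ := supnorm_seminorm Kcompact Kdet.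
have [p [pn p1 pmax]] := seminorm_extremal n z0 supQ.
have p0 : p != 0.
  by apply/eqP => p0; move: p1; rewrite p0 meval0 => /esym/eqP; rewrite oner_eq0.
have pz0 : polyabs p z0 = 1 by rewrite /polyabs p1 normc1.
have := supnorm_gt0 Kcompact Kdet p0.
set M := supnorm K p in pmax * => M0.
have M20 : 0 < M ^+ 2 by rewrite exprn_gt0.
have pv_ge mu : prob_on K mu -> ((M^-1 ^+ 2)%:E <= prediction_variance n K mu z0)%E.
  move=> muK; apply: (@le_trans _ _ (variance_ratio K mu z0 p)); last first.
    by apply: ereal_sup_ubound; exists p => //; split => //; rewrite p1 oner_neq0.
  rewrite /variance_ratio (mean_squareE Kcompact Kdet muK) pz0 expr1n mul1e inver.
  (* A zero mean square of [p] makes the ratio [+oo]. *)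
  case: eqVneq => [_|i0]; first exact: leey.
  have ip : 0 < mean_square K mu p by rewrite lt_neqAle eq_sym i0 mean_square_ge0.
  rewrite lee_fin exprVn lef_pV2 ?posrE //.
  exact: mean_square_le_supnorm Kcompact Kdet muK _.
have [mu muK muopt] := optimal_probability Kcompact Kdet (ltW M0) pmax.
exists (M^-1 ^+ 2); split.
- split; last by move=> _ [nu nuK <-]; exact: pv_ge.
  exists mu => //; apply/eqP; rewrite eq_le pv_ge // andbT.
  apply: ge_ereal_sup => _ [q [qn q0] <-].
  rewrite /variance_ratio (mean_squareE Kcompact Kdet muK).
  have q0' : 0 < polyabs q z0 by rewrite lt_neqAle polyabs_ge0 andbT eq_sym polyabs_eq0.
  have qi := muopt q qn.
  (* Optimality of [mu] keeps the denominator positive, so the ratio is real. *)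
  have iq : 0 < mean_square K mu q by apply: lt_le_trans qi; rewrite exprn_gt0 // mulr_gt0.
  rewrite inver gt_eqF // -EFinM lee_fin ler_pdivrMr // exprVn.
  by rewrite ler_pdivlMl // mulrC -exprMn.
- split.
    by exists p => //; rewrite pz0 expr1n div1r exprVn.
  move=> _ [q [qn q0] <-].
  have q0' := supnorm_gt0 Kcompact Kdet q0.
  have h : polyabs q z0 / supnorm K q <= M^-1.
    by rewrite ler_pdivrMr // ler_pdivlMl // mulrC pmax.
  rewrite -expr_div_n; apply: lerXn2r => //; rewrite nnegrE.
    by rewrite divr_ge0 ?polyabs_ge0 // ltW.
  by rewrite invr_ge0 ltW.
(* The maximizer is [p] divided by its supremum norm [M]. *)
exists M^-1 => //; split.
  exists ((M^-1)%:C%C *: p); last first.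
    by rewrite polyabsZ pz0 mulr1 normc_real ger0_norm // invr_ge0 ltW.
  split; first exact: poly_deg_leZ.
  by rewrite (seminormZ supQ) normc_real ger0_norm ?invr_ge0 ?(ltW M0) // mulVf ?lexx // gt_eqF.
move=> _ [q [qn q1] <-]; rewrite -[leRHS]mul1r ler_pdivlMr //.
exact: le_trans (pmax q qn) q1.
Qed.
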